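(* Assume that either (i) $\omega_b\subset\omega$ and $\omega_b$ satisfies the Geometric Control Condition (GCC), or (ii) $0\le b(x)\le b_+$ for all $x\in\Omega$ with $b_+\in(0,b^*]$, there is $b_->0$ with $b>b_-$ a.e. in $\omega_b$, and both $\omega_b$ and $\omega$ satisfy the Piecewise Multipliers Geometric Condition (PMGC). Assume moreover that $f_1,f_2$ satisfy Hypothesis (N) of the context (with Lipschitz function $L$), and that $$\|a_2^-\|_{L^\infty(\Omega)}<\frac{\tilde\alpha}{\tilde M},$$ where $\tilde M,\tilde\alpha>0$ are constants with $\|\tilde S(t)\|_{\mathcal L(\mathcal H)}\le\tilde Me^{-\tilde\alpha t}$ for all $t\ge0$. Let $T>0$ and let $U\in C([0,T);\mathcal H)$ be a solution of $$\dot U(t)=\tilde{\mathcal A}U(t)+a_2^-PU(t)+\mathcal F(U(t)),\ t>0,\qquad U(0)=U_0,$$ satisfying $\|U(t)\|_{\mathcal H}\le C_\rho$ for all $t\in[0,T)$, for some constant $C_\rho>0$ such that $$L(C_\rho)<\frac{\tilde\alpha-\tilde M\|a_2^-\|_{L^\infty(\Omega)}}{\tilde M}.$$ Then $$\|U(t)\|_{\mathcal H}\le\tilde M\|U_0\|_{\mathcal H}\,e^{-\left(\tilde\alpha-\tilde M\|a_2^-\|_{L^\infty(\Omega)}-\tilde ML(C_\rho)\right)t},\qquad\forall t\in[0,T).$$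
   Context: **Setting.** $\Omega\subset\mathbb R^n$ is a bounded open domain with boundary of class $C^2$; $a_1,b\in C^0(\overline\Omega,\mathbb R)$, $a_2\in L^\infty(\Omega)$ (real valued, possibly sign changing), $a_2^+=\max\{a_2,0\}$, $a_2^-=-\min\{a_2,0\}$; $a_1\ge 0$ a.e. in $\Omega$ and $a_1>a_0>0$ a.e. in a given open subset $\omega\subset\Omega$, for some constant $a_0$; $\omega_b$ is a non-empty open set with $\overline{\omega_b}\subset\{x\in\Omega: b(x)\ne 0\}$. The system considered is $$u_{tt}-\Delta u+b\,y_t+a_1u_t=f_1(u),\qquad y_{tt}-\Delta y-b\,u_t+a_2\,y_t=f_2(y)\quad\text{in }\Omega\times(0,\infty),$$ with $u=y=0$ on $\partial\Omega\times(0,\infty)$, $u(0)=u_0$, $u_t(0)=u_1$, $y(0)=y_0$, $y_t(0)=y_1$. **Abstract form.** $\mathcal H=(H_0^1(\Omega)\times L^2(\Omega))^2$ with norm $\|(u_1,u_2,y_1,y_2)\|_{\mathcal H}^2=\|\nabla u_1\|_{L^2}^2+\|u_2\|_{L^2}^2+\|\nabla y_1\|_{L^2}^2+\|y_2\|_{L^2}^2$. With $U=(u,u_t,y,y_t)$, $U_0=(u_0,u_1,y_0,y_1)\in\mathcal H$: $\tilde{\mathcal A}(u_1,u_2,y_1,y_2)=(u_2,\ \Delta u_1-by_2-a_1u_2,\ y_2,\ \Delta y_1+bu_2-a_2^+y_2)$ with domain $D(\tilde{\mathcal A})=((H^2(\Omega)\cap H_0^1(\Omega))\times H_0^1(\Omega))^2$;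 $P(u_1,u_2,y_1,y_2)=(0,0,0,y_2)$; $\mathcal F(u_1,u_2,y_1,y_2)=(0,f_1(u_1),0,f_2(y_1))$. $\tilde{\mathcal A}$ generates a contraction semigroup $(\tilde S(t))_{t\ge0}$ on $\mathcal H$. A solution is a mild solution, i.e. a continuous $\mathcal H$-valued function satisfying $$U(t)=\tilde S(t)U_0+\int_0^t\tilde S(t-s)a_2^-PU(s)\,ds+\int_0^t\tilde S(t-s)\mathcal F(U(s))\,ds.$$ **Geometric assumptions.** A subset $\omega\subset\Omega$ satisfies the Geometric Control Condition (GCC) if there is $T>0$ such that every ray of geometrical optics starting at any point $x\in\Omega$ at $t=0$ enters $\omega$ within time $T$. A subset $\omega\subset\Omega$ satisfies the Piecewise Multipliers Geometric Condition (PMGC) if there exist subsets $\Omega_j\subset\Omega$ with Lipschitz boundaries and points $x_j\in\mathbb R^n$, $j=1,\dots,J$, such that $\Omega_i\cap\Omega_j=\emptyset$ for $i\neq j$ and $\omega$ contains a neighborhood in $\Omega$ of $\bigcup_{j}\gamma_j(x_j)\cup(\Omega\setminus\bigcup_j\Omega_j)$, where $\gamma_j(x_j)=\{x\in\partial\Omega_j:(x-x_j)\cdot\nu_j(x)\ge0\}$ and $\nu_j$ is the outward unit normal to $\partial\Omega_j$. (G1): $\omega_b\subset\omega$ and $\omega_b$ satisfies the GCC. (G2): $0\le b(x)\le b_+$ for all $x\in\Omega$ with $b_+\in(0,b^*]$, there is $b_->0$ with $b>b_-$ a.e. in $\omega_b$, and both $\omega_b$ and $\omega$ satisfy the PMGC.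 Here $b^*>0$ is a constant depending on the domain and the control region, namely the threshold in the known result of Alabau-Boussouira, Wang and Yu giving exponential stability of the linear system with $a_2=0$, $f_1=f_2=0$. Under (G1) or (G2) there exist $\tilde M,\tilde\alpha>0$ with $\|\tilde S(t)\|_{\mathcal L(\mathcal H)}\le\tilde Me^{-\tilde\alpha t}$ for all $t\ge0$; $\tilde M,\tilde\alpha$ denote such constants. **Hypothesis (N).** $f_1,f_2:\mathbb R\to\mathbb R$ are continuous and: (1) $f_1(0)=f_2(0)=0$; (2) for every $r>0$ there is $L(r)>0$ such that for $i=1,2$, $\|f_i(u)-f_i(v)\|_{L^2(\Omega)}\le L(r)\|\nabla u-\nabla v\|_{L^2(\Omega)}$ for all $u,v\in H_0^1(\Omega)$ with $\|\nabla u\|_{L^2}\le r$, $\|\nabla v\|_{L^2}\le r$, and $L(r)\to0$ as $r\to0$; (3) there are strictly increasing continuous $h_1,h_2:\mathbb R_+\to\mathbb R_+$ with $h_i(0)=0$ and $\left|\int_\Omega f_i(u)u\,dx\right|\le h_i(\|\nabla u\|_{L^2})\|\nabla u\|_{L^2}^2$ for all $u\in H_0^1(\Omega)$, $i=1,2$. *)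

(* Defs.v *)
From HB Require Import structures.
From mathcomp Require Import all_boot all_order all_algebra.
From mathcomp Require Import all_classical all_reals all_analysis.

Set Implicit Arguments.
Unset Strict Implicit.
Unset Printing Implicit Defensive.

Import Order.TTheory GRing.Theory Num.Theory.
Import numFieldNormedType.Exports.

Local Open Scope classical_set_scope.
Local Open Scope ring_scope.

(** * Lebesgue measure on row vectors *)

Definition rV_display : measure_display.
Proof. exact: (measure_tuple_display default_measure_display). Qed.

Section rV_measurable.
Context {R : realType} {n : nat}.

Definition rV_coord (i : 'I_n) (x : 'rV[R]_n) : R := x ord0 i.

Let rV_set0 : g_sigma_preimage rV_coord set0.
Proof. exact: sigma_algebra0. Qed.

Let rV_setC A : g_sigma_preimage rV_coord A -> g_sigma_preimage rV_coord (~` A).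
Proof. exact: sigma_algebraC. Qed.

Let rV_bigcup (F : (set 'rV[R]_n)^nat) :
  (forall i, g_sigma_preimage rV_coord (F i)) ->
  g_sigma_preimage rV_coord (\bigcup_i (F i)).
Proof. exact: sigma_algebra_bigcup. Qed.

HB.instance Definition _ := @isMeasurable.Build rV_display 'rV[R]_n
  (g_sigma_preimage rV_coord) rV_set0 rV_setC rV_bigcup.

Lemma measurable_rV_coord i : measurable_fun [set: 'rV[R]_n] (rV_coord i).
Proof.
move=> _ Y mY; rewrite setTI; apply: sub_sigma_algebra => /=.
rewrite -bigcup_seq/=; exists i => /=; first by rewrite mem_index_enum.
by exists Y => //; rewrite setTI.
Qed.

Lemma measurable_fun_rVP d (T : measurableType d) (f : T -> 'rV[R]_n) :
  measurable_fun [set: T] f <->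
  forall i, measurable_fun [set: T] (rV_coord i \o f).
Proof.
split=> [mf i|mf].
  exact: measurableT_comp (measurable_rV_coord i) mf.
have sub : g_sigma_preimage (fun i => rV_coord i \o f) `<=` measurable.
  apply: smallest_sub; first exact: sigma_algebra_measurable.
  rewrite -bigcup_seq; apply: bigcup_sub => i _.
  by move=> A [B mB <-]; exact: mf.
move=> _ A mA; apply: sub.
by rewrite g_sigma_preimage_comp; exists A.
Qed.

End rV_measurable.

Section rV_cons.
Context {R : realType} {n : nat}.

Definition rV_cons (p : R * 'rV[R]_n) : 'rV[R]_n.+1 :=
  \row_i oapp (p.2 ord0) p.1 (unlift ord0 i).

Definition rV_uncons (x : 'rV[R]_n.+1) : R * 'rV[R]_n :=
  (x ord0 ord0, \row_i x ord0 (lift ord0 i)).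

Lemma rV_consK : cancel rV_cons rV_uncons.
Proof.
move=> [a v]; rewrite /rV_uncons /rV_cons; congr pair.
  by rewrite mxE unlift_none.
by apply/rowP => i; rewrite !mxE liftK.
Qed.

Lemma measurable_rV_cons : measurable_fun [set: R * 'rV[R]_n] rV_cons.
Proof.
apply/measurable_fun_rVP => i; rewrite /rV_cons.
case: (unliftP ord0 i) => [j ->|->].
  rewrite (_ : _ \o _ = rV_coord j \o snd).
    exact: measurableT_comp (measurable_rV_coord j) measurable_snd.
  by apply/funext => -[a v]; rewrite /rV_coord/= mxE liftK.
rewrite (_ : _ \o _ = fst); first exact: measurable_fst.
by apply/funext => -[a v]; rewrite /rV_coord/= mxE unlift_none.
Qed.

Lemma measurable_rV_uncons : measurable_fun [set: 'rV[R]_n.+1] rV_uncons.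
Proof.
apply: measurable_fun_pair; first exact: (measurable_rV_coord ord0).
apply/measurable_fun_rVP => i.
rewrite (_ : _ \o _ = rV_coord (lift ord0 i)); first exact: measurable_rV_coord.
by apply/funext => x; rewrite /rV_coord/= mxE.
Qed.

Variable m : {sigma_finite_measure set 'rV[R]_n -> \bar R}.

Definition lebesgue_rV_step : set 'rV[R]_n.+1 -> \bar R :=
  pushforward (@lebesgue_measure R \x m)%E rV_cons.

Let step0 : lebesgue_rV_step set0 = 0%E.
Proof. by rewrite /lebesgue_rV_step /pushforward preimage_set0 measure0. Qed.

Let step_ge0 A : (0 <= lebesgue_rV_step A)%E.
Proof.
rewrite /lebesgue_rV_step /pushforward.
exact: (measure_ge0 (@lebesgue_measure R \x m)%E).
Qed.

Let step_sigma_additive : semi_sigma_additive lebesgue_rV_step.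
Proof.
exact: (@measure_semi_sigma_additive _ _ _
  (measure_function_pushforward__canonical__measure_function_Measure
    (@lebesgue_measure R \x m)%E measurable_rV_cons)).
Qed.

HB.instance Definition _ := isMeasure.Build _ _ _ lebesgue_rV_step
  step0 step_ge0 step_sigma_additive.

Let step_sigma_finite : sigma_finite setT lebesgue_rV_step.
Proof.
have /sigma_finiteP[F [FT ndF Ffin]] := sigma_finiteT (@lebesgue_measure R).
have /sigma_finiteP[G [GT ndG Gfin]] := sigma_finiteT m.
exists (fun k => rV_uncons @^-1` (F k `*` G k)).
  rewrite -preimage_bigcup; apply/esym/seteqP; split=> // x _.
  have [i _ Fi] : (\bigcup_i F i) (rV_uncons x).1 by rewrite -FT.
  have [j _ Gj] : (\bigcup_i G i) (rV_uncons x).2 by rewrite -GT.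
  exists (maxn i j) => //; split.
    by move: Fi; exact/subsetPset/ndF/leq_maxl.
  by move: Gj; exact/subsetPset/ndG/leq_maxr.
move=> k; have [mF Fk] := Ffin k; have [mG Gk] := Gfin k; split.
  rewrite -[X in measurable X]setTI; apply: measurable_rV_uncons => //.
  exact: measurableX.
rewrite /lebesgue_rV_step /pushforward -comp_preimage.
rewrite (_ : _ \o _ = id); last by apply/funext => p; exact: rV_consK.
by rewrite [ltLHS]product_measure1E// lte_mul_pinfty// ge0_fin_numE.
Qed.

HB.instance Definition _ := Measure_isSigmaFinite.Build _ _ _ lebesgue_rV_step
  step_sigma_finite.

End rV_cons.

(** [R^0] is a point of mass one, and [R^(n+1)] carries the image of the product
    measure on [R * R^n]. *)
Fixpoint lebesgue_rV (R : realType) (n : nat) :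
    {sigma_finite_measure set 'rV[R]_n -> \bar R} :=
  match n with
  | 0%N => \d_(0 : 'rV[R]_0)
  | k.+1 => lebesgue_rV_step (lebesgue_rV R k)
  end.

(** * Euclidean geometry of [R^n]

    The norm carried by ['rV[R]_n] is the sup norm, which gives the usual
    topology; Euclidean lengths and angles are the following. *)

Section euclidean.
Context {R : realType} {n : nat}.
Local Notation E := 'rV[R]_n.

Definition dot (x y : E) : R := \sum_i x ord0 i * y ord0 i.

Definition enorm (x : E) : R := Num.sqrt (dot x x).

Definition basis_vec (i : 'I_n) : E := delta_mx ord0 i.

Definition partial (i : 'I_n) (f : E -> R) : E -> R := 'D_(basis_vec i) f.

Definition grad (f : E -> R) (x : E) : E := \row_i partial i f x.

Fixpoint Ck (k : nat) (U : set E) (f : E -> R) : Prop :=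
  (forall x, U x -> {for x, continuous f}) /\
  match k with
  | 0%N => True
  | j.+1 => forall i, (forall x, U x -> derivable f x (basis_vec i)) /\
                      Ck j U (partial i f)
  end.

Definition boundary (D : set E) : set E := closure D `\` D°.

(** Near each of its boundary points, [D] is the part below the graph of a
    function of class [K] over a hyperplane, with upward unit vector [e]; [g] is
    only used on the orthogonal of [e]. *)
Definition boundary_of_class (K : set (E -> R)) (D : set E) : Prop :=
  forall p, boundary D p -> exists (e : E) (g : E -> R),
    [/\ enorm e = 1, K g &
        \forall y \near p, D y <-> dot y e < g (y - dot y e *: e)].

Definition C2_boundary : set E -> Prop := boundary_of_class (Ck 2 setT).

Definition lipschitz_boundary : set E -> Prop :=
  boundary_of_class [set g | exists k : R, k.-lipschitz g].

(** * Piecewise Multipliers Geometric Condition *)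

Definition outward_unit_normal (D : set E) (x nu : E) : Prop :=
  enorm nu = 1 /\ forall eps : R, 0 < eps -> \forall y \near x,
    (dot (y - x) nu < - eps * enorm (y - x) -> D y) /\
    (eps * enorm (y - x) < dot (y - x) nu -> ~ D y).

(** A Lipschitz boundary has a normal at almost all of its points; the others
    are left out. *)
Definition gamma_part (D : set E) (x0 : E) : set E :=
  [set x | boundary D x /\
           exists2 nu, outward_unit_normal D x nu & 0 <= dot (x - x0) nu].

Definition PMGC (Omega omega : set E) : Prop :=
  exists (J : nat) (D : 'I_J -> set E) (x0 : 'I_J -> E),
    [/\ forall j, D j `<=` Omega /\ lipschitz_boundary (D j),
        forall i j, i != j -> D i `&` D j = set0 &
        exists V : set E, [/\ open V,
          \bigcup_j gamma_part (D j) (x0 j) `|` (Omega `\` \bigcup_j D j)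
            `<=` V &
          V `&` Omega `<=` omega]].

(** * Geometric Control Condition *)

Definition defining_function (Omega : set E) (p : E) (phi : E -> R) : Prop :=
  exists V : set E, [/\ open V, V p, Ck 2 V phi,
    forall y, V y -> (Omega y <-> phi y < 0) &
    forall y, V y -> grad phi y != 0].

(** The position [x] and the velocity [xi] of a ray (a generalized
    bicharacteristic in the sense of Melrose and Sjostrand, for the flat metric
    and speed one) at a time [t] that is not an instant of reflection. Inside
    [Omega] the ray is straight. On the boundary it is tangent: it stays straight
    where the boundary curves away from it (diffractive points), and otherwise
    its acceleration is that of the boundary geodesic. *)
Definition ray_regular (Omega : set E) (x xi : R -> E) (t : R) : Prop :=
  exists k : E,
    [/\ is_derive t 1 x (xi t), is_derive t 1 xi k,
        Omega (x t) -> k = 0 &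
        ~ Omega (x t) -> exists phi,
          [/\ defining_function Omega (x t) phi,
              dot (xi t) (grad phi (x t)) = 0 &
              k = - (Num.max 0 ('D_(xi t) ('D_(xi t) phi) (x t))
                     / dot (grad phi (x t)) (grad phi (x t)))
                  *: grad phi (x t)]].

Definition ray_reflected (Omega : set E) (x xi : R -> E) (t : R) : Prop :=
  [/\ ~ Omega (x t), (\forall s \near t^', Omega (x s)) &
      exists (xl xr : E) (phi : E -> R),
        [/\ xi s @[s --> t^'-] --> xl, xi s @[s --> t^'+] --> xr,
            defining_function Omega (x t) phi,
            dot xl (grad phi (x t)) != 0 &
            xr = xl - (2 * dot xl (grad phi (x t))
                       / dot (grad phi (x t)) (grad phi (x t)))
                      *: grad phi (x t)]].

Definition optical_ray (Omega : set E) (x xi : R -> E) : Prop :=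
  [/\ {within `[0, +oo[, continuous x},
      xi s @[s --> 0^'+] --> xi 0,
      forall t : R, 0 <= t -> closure Omega (x t) /\ enorm (xi t) = 1 &
      forall t : R, 0 < t -> ray_regular Omega x xi t \/ ray_reflected Omega x xi t].

Definition GCC (Omega omega : set E) : Prop :=
  exists2 T : R, 0 < T & forall x xi, optical_ray Omega x xi -> Omega (x 0) ->
    exists2 t : R, 0 <= t <= T & omega (x t).

End euclidean.

(** * Sobolev spaces

    A function on [Omega] is represented by a function on the whole space, whose
    values outside of [Omega] are irrelevant. *)

Section sobolev.
Context {R : realType} {n : nat}.
Local Notation E := 'rV[R]_n.
Local Notation mu := (lebesgue_rV R n).
Implicit Types (Omega : set E) (u v w f : E -> R).

Definition L2 Omega : set (E -> R) := [set f | f \_ Omega \in Lfun mu 2%:E].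

Definition L2enorm Omega f : \bar R := 'N[mu]_2%:E[EFin \o (f \_ Omega)].

Definition L2norm Omega f : R := fine (L2enorm Omega f).

Definition Linfty Omega : set (E -> R) := [set f | f \_ Omega \in Lfun mu +oo%E].

Definition Linfty_norm Omega f : R := fine 'N[mu]_+oo[EFin \o (f \_ Omega)].

Definition test_function Omega : set (E -> R) :=
  [set phi | (forall k, Ck k setT phi) /\
    exists K : set E, [/\ compact K, K `<=` Omega & forall x, ~ K x -> phi x = 0]].

Definition weak_partial Omega (i : 'I_n) u v : Prop :=
  forall psi, test_function Omega psi ->
    (\int[mu]_(x in Omega) (u x * partial i psi x) =
     - \int[mu]_(x in Omega) (v x * psi x))%R.

Definition H1_gradient Omega u (g : 'I_n -> E -> R) : Prop :=
  L2 Omega u /\ forall i, L2 Omega (g i) /\ weak_partial Omega i u (g i).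

(** [u] is in [H^1_0], the closure of the test functions in [H^1], and [g] is its
    weak gradient. *)
Definition H01_gradient Omega u (g : 'I_n -> E -> R) : Prop :=
  H1_gradient Omega u g /\
  exists phi : (E -> R)^nat,
    [/\ forall k, test_function Omega (phi k),
        L2enorm Omega (u - phi k) @[k --> \oo] --> 0%E &
        forall i, L2enorm Omega (g i - partial i (phi k)) @[k --> \oo] --> 0%E].

Definition H01 Omega : set (E -> R) := [set u | exists g, H01_gradient Omega u g].

(** A representative of the weak gradient, which is unique up to equality
    almost everywhere. *)
Definition weak_grad Omega u : 'I_n -> E -> R := get (H01_gradient Omega u).

Definition grad_norm Omega u : R :=
  Num.sqrt (\sum_i L2norm Omega (weak_grad Omega u i) ^+ 2).

(** [u] is in [H^2], with Laplacian [w]. *)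
Definition H2_laplacian Omega u w : Prop :=
  exists (g : 'I_n -> E -> R) (h : 'I_n -> 'I_n -> E -> R),
    [/\ H1_gradient Omega u g,
        forall i, H1_gradient Omega (g i) (h i) &
        w = \sum_i h i i].

End sobolev.

(** * Semigroups on a seminormed space

    The space is the subspace [H] of [V], with the seminorm [N]; its elements
    at distance zero are identified. *)

Section semigroup.
Context {R : realType} {V : lmodType R}.
Variables (H : set V) (N : V -> R).

Definition C0_semigroup (S : R -> V -> V) : Prop :=
  [/\ forall (t : R) u, 0 <= t -> H u -> H (S t u),
      forall (t a : R) u v, 0 <= t -> H u -> H v ->
        N (S t (a *: u + v) - (a *: S t u + S t v)) = 0,
      forall t : R, 0 <= t -> exists C : R, forall u, H u -> N (S t u) <= C * N u,
      (forall u, H u -> N (S 0 u - u) = 0) /\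
      (forall (s t : R) u, 0 <= s -> 0 <= t -> H u -> N (S (s + t) u - S s (S t u)) = 0) &
      forall u, H u -> N (S t u - u) @[t --> 0^'+] --> 0].

(** [A u v] stands for: [u] is in the domain of [A], and [A u = v]. *)
Definition generates (A : V -> V -> Prop) (S : R -> V -> V) : Prop :=
  C0_semigroup S /\
  forall u v, H u -> H v ->
    (A u v <-> N (t^-1 *: (S t u - u) - v) @[t --> 0^'+] --> 0).

Definition opnorm_le (F : V -> V) (C : R) : Prop :=
  forall u, H u -> N (F u) <= C * N u.

Definition contraction_semigroup (S : R -> V -> V) : Prop :=
  C0_semigroup S /\ forall t : R, 0 <= t -> opnorm_le (S t) 1.

(** [I] is the integral of the continuous function [f] on [[a, b]], as the limit
    of its Riemann sums. *)
Definition is_integral (f : R -> V) (a b : R) (I : V) : Prop :=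
  forall eps : R, 0 < eps -> exists2 delta : R, 0 < delta &
    forall (m : nat) (p c : nat -> R), p 0%N = a -> p m = b ->
      (forall k, (k < m)%N -> p k <= c k <= p k.+1 /\ p k.+1 - p k < delta) ->
      N (\sum_(k < m) (p k.+1 - p k) *: f (c k) - I) < eps.

Definition continuous_on (T : R) (U : R -> V) : Prop :=
  (forall t : R, 0 <= t < T -> H (U t)) /\
  forall t : R, 0 <= t < T ->
    N (U s - U t) @[s --> within `[0, T[ (nbhs t)] --> 0.

(** Mild solution in [C([0, T); H)] of [U' = A U + B U + F U], [U 0 = U0], where
    [A] generates [S]. *)
Definition mild_solution (S : R -> V -> V) (B F : V -> V) (U0 : V) (T : R)
    (U : R -> V) : Prop :=
  continuous_on T U /\
  forall t : R, 0 <= t < T -> exists I1 I2 : V,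
    [/\ H I1 /\ H I2,
        is_integral (fun s => S (t - s) (B (U s))) 0 t I1,
        is_integral (fun s => S (t - s) (F (U s))) 0 t I2 &
        N (U t - (S t U0 + I1 + I2)) = 0].

End semigroup.

(** * The coupled wave system *)

Section system.
Context {R : realType} {n : nat}.
Local Notation E := 'rV[R]_n.
Local Notation mu := (lebesgue_rV R n).
Variable Omega : set E.

Definition state : lmodType R :=
  ((E -> R^o) * (E -> R^o) * (E -> R^o) * (E -> R^o))%type.

Definition energy_space : set state := [set U |
  let: (u1, u2, y1, y2) := U in
  [/\ H01 Omega u1, L2 Omega u2, H01 Omega y1 & L2 Omega y2]].

Definition energy_norm (U : state) : R :=
  let: (u1, u2, y1, y2) := U in
  Num.sqrt (grad_norm Omega u1 ^+ 2 + L2norm Omega u2 ^+ 2 +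
            grad_norm Omega y1 ^+ 2 + L2norm Omega y2 ^+ 2).

(** The operator [Atilde] with damping coefficients [a1] and [d]; [w] and [z] are
    the Laplacians of [u1] and [y1]. *)
Definition wave_operator (a1 b d : E -> R) (U V : state) : Prop :=
  let: (u1, u2, y1, y2) := U in
  [/\ H01 Omega u1 /\ H01 Omega y1, H01 Omega u2 /\ H01 Omega y2 &
  exists w z : E -> R,
  [/\ H2_laplacian Omega u1 w, H2_laplacian Omega y1 z &
      energy_norm (V - (u2, w - b \* y2 - a1 \* u2,
                        y2, z + b \* u2 - d \* y2)) = 0]].

Definition proj_P (U : state) : state :=
  let: (u1, u2, y1, y2) := U in (0, 0, 0, y2).

Definition nonlinearity (f1 f2 : R -> R) (U : state) : state :=
  let: (u1, u2, y1, y2) := U in (0, f1 \o u1, 0, f2 \o y1).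

Definition pointwise_mul (a : E -> R) (U : state) : state :=
  let: (u1, u2, y1, y2) := U in (a \* u1, a \* u2, a \* y1, a \* y2).

Definition damping_coefficient (omega : set E) (a1 : E -> R) : Prop :=
  [/\ {within closure Omega, continuous a1},
      {ae mu, forall x, Omega x -> 0 <= a1 x} &
      exists2 a0 : R, 0 < a0 & {ae mu, forall x, omega x -> a0 < a1 x}].

Definition coupling_coefficient (omegab : set E) (b : E -> R) : Prop :=
  {within closure Omega, continuous b} /\
  closure omegab `<=` [set x | Omega x /\ b x != 0].

Definition exp_bound (S : R -> state -> state) (M alpha : R) : Prop :=
  forall t : R, 0 <= t ->
    opnorm_le energy_space energy_norm (S t) (M * expR (- alpha * t)).

Definition wave_semigroup (a1 b d : E -> R) (S : R -> state -> state) : Prop :=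
  generates energy_space energy_norm (wave_operator a1 b d) S.

Definition coupling_between (omegab : set E) (b : E -> R) (bplus : R) : Prop :=
  (forall x, Omega x -> 0 <= b x <= bplus) /\
  exists2 bminus : R, 0 < bminus & {ae mu, forall x, omegab x -> bminus < b x}.

(** [bstar] is a threshold as in the theorem of Alabau-Boussouira, Wang and Yu:
    it only depends on the regions, and the linear system without damping of the
    second equation is exponentially stable for all couplings up to [bstar]. *)
Definition coupling_threshold (omega omegab : set E) (bstar : R) : Prop :=
  0 < bstar /\
  forall (a1 b : E -> R) (bplus : R) (S : R -> state -> state),
    damping_coefficient omega a1 -> coupling_coefficient omegab b ->
    0 < bplus <= bstar -> coupling_between omegab b bplus ->
    PMGC Omega omegab -> PMGC Omega omega ->
    wave_semigroup a1 b (cst 0) S ->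
    exists M alpha : R, [/\ 0 < M, 0 < alpha & exp_bound S M alpha].

Definition geometric_control (omega omegab : set E) : Prop :=
  omegab `<=` omega /\ GCC Omega omegab.

Definition piecewise_multipliers (omega omegab : set E) (b : E -> R)
    (bstar : R) : Prop :=
  [/\ coupling_threshold omega omegab bstar,
      exists2 bplus : R, 0 < bplus <= bstar & coupling_between omegab b bplus,
      PMGC Omega omegab & PMGC Omega omega].

Definition hypothesis_N (f1 f2 : R -> R) (L : R -> R) : Prop :=
  [/\ continuous f1 /\ continuous f2,
      f1 0 = 0 /\ f2 0 = 0,
      forall r : R, 0 < r -> 0 < L r /\
        forall f, f = f1 \/ f = f2 -> forall u v, H01 Omega u -> H01 Omega v ->
          grad_norm Omega u <= r -> grad_norm Omega v <= r ->
          (L2enorm Omega ((f \o u) - (f \o v))%R <=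
             (L r * grad_norm Omega (u - v))%:E)%E,
      L r @[r --> 0^'+] --> 0 &
      forall f, f = f1 \/ f = f2 -> exists h : R -> R,
        [/\ {within `[0, +oo[, continuous h},
            {in `[0, +oo[ &, {homo h : s t / s < t}},
            h 0 = 0 &
            forall u, H01 Omega u ->
              `| \int[mu]_(x in Omega) (f (u x) * u x) | <=
                h (grad_norm Omega u) * grad_norm Omega u ^+ 2]].

End system.

Arguments state R n : clear implicits.

(* Main.v *)
(** Duhamel's formula, the exponential bound on the semigroup and the Lipschitz
    bounds [|a2^- P U| <= |a2^-|_oo |U|] and [|F U| <= L(Crho) |U|] reduce the
    theorem to Gronwall's inequality for [t |-> |U t|]. The quantities on
    [H^1_0 x L^2 x H^1_0 x L^2] are only seminorms on representatives, so the
    triangle inequality for the energy norm also requires that the chosen weak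
    gradient of a function be unique up to a null set. *)

Require Import Defs.
From HB Require Import structures.
From mathcomp Require Import all_boot all_order all_algebra.
From mathcomp Require Import all_classical all_reals all_analysis.
From mathcomp Require Import measurable_realfun ess_sup_inf.
From mathcomp Require Import ring lra.

Set Implicit Arguments.
Unset Strict Implicit.
Unset Printing Implicit Defensive.

Import Order.TTheory GRing.Theory Num.Theory.
Import numFieldNormedType.Exports.

Local Open Scope classical_set_scope.
Local Open Scope ring_scope.

(** * Gronwall's inequality for mild solutions *)

(** The a priori bound [Crho] serves twice. It confines the solution to a ball on which the
    nonlinearity, compared with its value 0 at 0, grows at most linearly with the fixed constant
    [L Crho]; and it makes the weighted supremum of the norm finite, without which nothing could be
    absorbed. The integrals are given only as limits of Riemann sums, so their norms are estimated
    by majorizing the integrand with a multiple of exp(k s), whose sums compare with an explicit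
    primitive. This yields exp(alpha t) |U t| <= M |U0| exp(k t) for each k above M (|a2^-|_oo +
    L(Crho)), and the stated rate is the limiting case. On the functional side, test functions have
    to be square integrable on [Omega]: this rests on [Omega] being bounded, hence of finite
    measure, and open, hence measurable for the sigma-algebra generated by the coordinates. *)

Section seminormed_subspace.
Context {R : realType} {V : lmodType R}.
Variables (H : set V) (N : V -> R).

(** The laws are relative to [H] because off the energy space the energy norm is built from default
    values of [get] and [fine]. Definiteness is absent: representatives that agree almost everywhere
    are at distance zero. *)
Definition is_seminorm_on : Prop :=
  [/\ H 0, forall (a : R) u v, H u -> H v -> H (a *: u + v),
      forall u v, H u -> H v -> N (u + v) <= N u + N v &
      forall (a : R) u, H u -> N (a *: u) = `|a| * N u].

Hypothesis HN : is_seminorm_on.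

Let H0 : H 0. Proof. by have [] := HN. Qed.

Let HD u v : H u -> H v -> H (u + v).
Proof. have [_ HP _ _] := HN; move=> Hu Hv; rewrite -[u]scale1r; exact: HP. Qed.

Let HZ (a : R) u : H u -> H (a *: u).
Proof. have [_ HP _ _] := HN; move=> Hu; rewrite -[_ *: _]addr0; exact: HP. Qed.

Let HB u v : H u -> H v -> H (u - v).
Proof. by move=> Hu Hv; rewrite -scaleN1r; apply: HD => //; exact: HZ. Qed.

Let ND u v : H u -> H v -> N (u + v) <= N u + N v.
Proof. by have [_ _ + +] := HN; auto. Qed.

Let NZ (a : R) u : H u -> N (a *: u) = `|a| * N u.
Proof. by have [_ _ + +] := HN; auto. Qed.

Lemma seminorm_subC u v : H u -> H v -> N (u - v) = N (v - u).
Proof.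
by move=> Hu Hv; rewrite -(opprB v) -(scaleN1r (v - u)) NZ ?normrN1 ?mul1r//; exact: HB.
Qed.

Lemma seminorm_ge0 u : H u -> 0 <= N u.
Proof.
move=> Hu; have := ND Hu (HZ (-1) Hu).
rewrite scaleN1r subrr -[X in N X](scale0r 0) NZ// normr0 mul0r.
by rewrite -scaleN1r NZ// normrN1 mul1r -mulr2n pmulrn_lge0.
Qed.

Lemma seminorm_le_sub u v : H u -> H v -> N u <= N v + N (u - v).
Proof. by move=> Hu Hv; rewrite -{1}(subrKC v u) ND//; exact: HB. Qed.

Lemma seminorm_sum_le m (a : nat -> R) (x : nat -> V) :
  (forall k, (k < m)%N -> 0 <= a k /\ H (x k)) ->
  H (\sum_(k < m) a k *: x k) /\
  N (\sum_(k < m) a k *: x k) <= \sum_(k < m) a k * N (x k).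
Proof.
elim: m => [|m ih] ax.
  by rewrite !big_ord0 -[X in N X](scale0r 0) NZ// normr0 mul0r.
have [am Hm] := ax _ (ltnSn m); have [Hs Ns] := ih (fun k km => ax k (ltnW km)).
rewrite !big_ord_recr/=; split; first by apply: HD => //; exact: HZ.
apply: le_trans (ND Hs (HZ _ Hm)) _.
by rewrite NZ// ger0_norm// lerD2r.
Qed.

(* The left Riemann sums of the increasing convex bound [c * expR (k * s)] lie
   below its integral, by [1 + x <= expR x]. *)
Lemma is_integral_norm_le (f : R -> V) (t c k : R) (I : V) :
  0 <= t -> 0 <= c -> 0 < k ->
  (forall s, 0 <= s <= t -> H (f s) /\ N (f s) <= c * expR (k * s)) ->
  H I -> is_integral N f 0 t I ->
  N I <= c / k * (expR (k * t) - 1).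
Proof.
move=> t0 c0 k0 Hf HI fI; apply/ler_addgt0Pr => e e0.
have [d d0 fd] := fI _ e0.
(* Enough equal steps for the mesh t / m to drop below d; the successor keeps m positive even when t
   = 0. *)
pose m := (Num.truncn (t / d)).+1.
have m0 : 0 < m%:R :> R by rewrite ltr0n.
pose p (j : nat) : R := j%:R * (t / m%:R).
have pS j : p j.+1 - p j = t / m%:R.
  by rewrite /p -natr1 mulrDl mul1r addrC addKr.
have tm0 : 0 <= t / m%:R by rewrite divr_ge0// ltW.
have tmd : t / m%:R < d.
  by rewrite ltr_pdivrMr// mulrC -ltr_pdivrMr// truncnS_gt.
have p0t j : (j < m)%N -> 0 <= p j <= t.
  move=> jm; rewrite /p mulr_ge0//= mulrA ler_pdivrMr// mulrC ler_wpM2l//.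
  by rewrite ler_nat ltnW.
have pm : p m = t by rewrite /p mulrC divfK// gt_eqF.
have p0 : p 0%N = 0 by rewrite /p mul0r.
have pd j : (j < m)%N -> p j <= p j <= p j.+1 /\ p j.+1 - p j < d.
  by move=> _; rewrite lexx/= -subr_ge0 pS.
have NI := fd m p p p0 pm pd.
have [] := @seminorm_sum_le m (fun j => p j.+1 - p j) (f \o p).
  by move=> j jm; rewrite pS; split => //; apply: (Hf _ _).1; exact: p0t.
move=> /= Hs Ns.
apply: le_trans (seminorm_le_sub HI Hs) _; rewrite seminorm_subC//.
rewrite lerD ?(ltW NI)//; apply: le_trans Ns _.
(* The intermediate sum collects the increments of the primitive c / k * exp(k s), so it
   telescopes. *)
apply: (@le_trans _ _
    (\sum_(j < m) (c / k * expR (k * p j.+1) - c / k * expR (k * p j)))).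
  apply: ler_sum => j _; have jm := ltn_ord j.
  apply: (@le_trans _ _ ((p j.+1 - p j) * (c * expR (k * p j)))).
    by rewrite ler_wpM2l ?pS//; apply: (Hf _ _).2; exact: p0t.
  have -> : k * p j.+1 = k * p j + k * (p j.+1 - p j) by ring.
  rewrite expRD -mulrBr -[X in _ * (_ - X)]mulr1 -mulrBr.
  have := expR_ge1Dx (k * (p j.+1 - p j)); rewrite -lerBrDl => ex.
  have -> : (p j.+1 - p j) * (c * expR (k * p j)) =
     c / k * (expR (k * p j) * (k * (p j.+1 - p j))).
    by field; rewrite gt_eqF//.
  by rewrite !ler_wpM2l ?expR_ge0// divr_ge0// ltW.
rewrite -(big_mkord xpredT (fun j => c / k * expR (k * p j.+1) - c / k * expR (k * p j))).
by rewrite telescope_sumr// pm p0 mulr0 expR0 mulrBr.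
Qed.

(* Weighting by [expR (- k * t)] with [k] above the critical rate [M * K] turns
   the Duhamel inequality into a strict contraction for the supremum over
   [[0, T)], so no integral form of Gronwall's lemma is needed. *)
Lemma duhamel_sup_le (phi : R -> R) (A q k T C : R) :
  0 <= A -> 0 <= q < 1 -> 0 < k ->
  (forall t, 0 <= t < T -> 0 <= phi t <= C) ->
  (forall m, 0 <= m -> (forall s, 0 <= s < T -> phi s <= m * expR (k * s)) ->
     forall t, 0 <= t < T -> phi t <= A + q * m * (expR (k * t) - 1)) ->
  forall t, 0 <= t < T -> phi t <= A * expR (k * t).
Proof.
move=> A0 /andP[q0 q1] k0 phiC step t tT.
pose E := [set phi s * expR (- (k * s)) | s in [set s | 0 <= s < T]].
(* Absorbing [q * sup E] is legitimate only for a finite supremum, which the bound [C] provides. *)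
have supE : has_sup E.
  split; first by exists (phi t * expR (- (k * t))); exists t.
  exists C => _ [s /= sT <-]; have /andP[p0 pC] := phiC _ sT.
  apply: le_trans pC; rewrite ler_piMr// -expR0 ler_expR oppr_le0.
  by case/andP: sT => s0 _; rewrite mulr_ge0 ?(ltW k0).
have phiE s : 0 <= s < T -> phi s <= sup E * expR (k * s).
  move=> sT; rewrite -ler_pdivrMr ?expR_gt0// -expRN.
  by apply: (ub_le_sup supE.2); exists s.
have m0 : 0 <= sup E.
  rewrite -(@pmulr_lge0 _ (expR (k * t))) ?expR_gt0//.
  by apply: le_trans (phiE _ tT); have /andP[] := phiC _ tT.
suff mA : sup E <= A.
  by apply: le_trans (phiE _ tT) _; rewrite ler_wpM2r ?expR_ge0.
rewrite leNgt; apply/negP => Am.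
(* With e = exp(k s) >= 1, both coefficients in A + q m (e - 1) are at most the maximum x, and x + x
   (e - 1) = x e. If A < sup E, then sup E is positive and q < 1 puts the maximum strictly below
   it. *)
have : sup E <= Num.max A (q * sup E).
  apply: ge_sup; first exact: supE.1.
  move=> _ [s /= sT <-]; rewrite expRN ler_pdivrMr ?expR_gt0//.
  apply: le_trans (step _ m0 phiE _ sT) _.
  have e1 : 1 <= expR (k * s).
    by case/andP: sT => s0 _; rewrite -expR0 ler_expR mulr_ge0 ?(ltW k0).
  set x := Num.max _ _.
  have -> : x * expR (k * s) = x + x * (expR (k * s) - 1) by ring.
  by rewrite lerD ?ler_wpM2r ?subr_ge0// le_max lexx ?orbT.
rewrite le_max leNgt Am/= leNgt => /negP; apply.
by rewrite gtr_pMl// (le_lt_trans A0 Am).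
Qed.

(** The kernel exp(- alpha (t - s)) factors, so that exp(alpha t) N(U t) obeys a Duhamel inequality
    with the constant M (K1 + K2) and no exponential kernel. For k > M (K1 + K2) the contraction
    factor is q = M (K1 + K2) / k; then k decreases to M (K1 + K2). *)
Lemma mild_solution_decay (S : R -> V -> V) (B F : V -> V) (U0 : V) (T : R)
    (U : R -> V) (M alpha K1 K2 C : R) :
  0 < M -> 0 <= K1 -> 0 <= K2 -> H U0 ->
  (forall t u, 0 <= t -> H u -> H (S t u)) ->
  (forall t, 0 <= t -> opnorm_le H N (S t) (M * expR (- alpha * t))) ->
  (forall t, 0 <= t < T -> [/\ N (U t) <= C,
     H (B (U t)) /\ N (B (U t)) <= K1 * N (U t) &
     H (F (U t)) /\ N (F (U t)) <= K2 * N (U t)]) ->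
  mild_solution H N S B F U0 T U ->
  forall t, 0 <= t < T ->
    N (U t) <= M * N U0 * expR (- (alpha - M * K1 - M * K2) * t).
Proof.
move=> M0 K10 K20 HU0 HS NS UBF [[HU _] Ueq].
pose A := M * N U0.
have A0 : 0 <= A by rewrite mulr_ge0 ?seminorm_ge0// ltW.
have bound k : M * (K1 + K2) < k -> forall t, 0 <= t < T ->
    N (U t) * expR (alpha * t) <= A * expR (k * t).
  move=> Kk.
  have MK0 : 0 <= M * (K1 + K2) by rewrite mulr_ge0 ?addr_ge0// ltW.
  have k0 : 0 < k by exact: le_lt_trans Kk.
  (* The absolute value of [alpha] in the last argument makes it a bound on [0, T) for either sign
     of [alpha]. *)
  apply: (@duhamel_sup_le (fun t => N (U t) * expR (alpha * t)) A
      (M * (K1 + K2) / k) k T (C * expR (`|alpha| * T))) => //.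
  - by rewrite divr_ge0 ?(ltW k0)//= ltr_pdivrMr// mul1r.
  - move=> t tT; have [NC _ _] := UBF _ tT; have Nt := seminorm_ge0 (HU _ tT).
    rewrite mulr_ge0 ?expR_ge0//= ler_pM ?expR_ge0// ler_expR.
    case/andP: tT => t0 /ltW tT.
    apply: le_trans (ler_wpM2r t0 (ler_norm _)) _.
    by rewrite ler_wpM2l.
  move=> m m0 Um t /[dup] tT /andP[t0 tT'].
  have [I1 [I2 [[HI1 HI2] I1E I2E NE]]] := Ueq _ tT.
  have HSt : H (S t U0) by exact: HS.
  have part (G : V -> V) (K : R) (I : V) : 0 <= K ->
      (forall s, 0 <= s < T -> H (G (U s)) /\ N (G (U s)) <= K * N (U s)) ->
      H I -> is_integral N (fun s => S (t - s) (G (U s))) 0 t I ->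
      N I <= M * expR (- alpha * t) * K * m / k * (expR (k * t) - 1).
    move=> K0 GK HI IE; apply: (is_integral_norm_le t0 _ k0 _ HI IE).
      by rewrite !mulr_ge0 ?expR_ge0// ltW.
    move=> s /andP[s0 st].
    have sT : 0 <= s < T by rewrite s0 (le_lt_trans st).
    have [HG NG] := GK _ sT.
    have ts0 : 0 <= t - s by rewrite subr_ge0.
    split; first exact: HS.
    apply: le_trans (NS _ ts0 _ HG) _.
    have -> : - alpha * (t - s) = - alpha * t + alpha * s by ring.
    rewrite expRD.
    have -> : M * (expR (- alpha * t) * expR (alpha * s)) * N (G (U s)) =
      M * expR (- alpha * t) * (N (G (U s)) * expR (alpha * s)) by ring.
    rewrite -!mulrA !ler_wpM2l ?expR_ge0 ?(ltW M0)//.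
    apply: le_trans (ler_wpM2r (expR_ge0 _) NG) _.
    by rewrite -mulrA ler_wpM2l// Um.
  have NI1 := part B K1 I1 K10 (fun s sT => let: And3 _ h _ := UBF s sT in h) HI1 I1E.
  have NI2 := part F K2 I2 K20 (fun s sT => let: And3 _ _ h := UBF s sT in h) HI2 I2E.
  have NUt : N (U t) <= M * expR (- alpha * t) * N U0 + N I1 + N I2.
    apply: le_trans (seminorm_le_sub (HU _ tT) (HD (HD HSt HI1) HI2)) _.
    rewrite NE addr0; apply: le_trans (ND (HD HSt HI1) HI2) _.
    rewrite lerD2r; apply: le_trans (ND HSt HI1) _.
    by rewrite lerD2r; exact: NS.
  rewrite -ler_pdivlMr ?expR_gt0// -expRN -mulNr.
  apply: le_trans NUt _; apply: le_trans (lerD (lerD (lexx _) NI1) NI2) _.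
  rewrite le_eqVlt; apply/orP; left; apply/eqP.
  rewrite /A; field; rewrite gt_eqF//.
move=> t /[dup] tT /andP[t0 _]; apply/ler_addgt0Pr => e e0.
pose B0 := A * expR (- (alpha - M * K1 - M * K2) * t).
have B00 : 0 <= B0 by rewrite mulr_ge0 ?expR_ge0.
(* Exceeding the critical rate by x / (t + 1) costs at time t a factor of at most exp(x) = 1 + e /
   (B0 + 1), hence an additive error of at most e. The added ones keep the denominators positive
   when t = 0 or B0 = 0. *)
pose x := ln (1 + e / (B0 + 1)).
have eB : 0 < e / (B0 + 1) by rewrite divr_gt0// ltr_wpDl.
have x0 : 0 < x by rewrite ln_gt0// ltrDl.
have t10 : 0 < t + 1 by rewrite ltr_wpDl.
have := bound (M * (K1 + K2) + x / (t + 1)) _ _ tT.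
rewrite ltrDl divr_gt0// => /(_ isT); rewrite -ler_pdivlMr ?expR_gt0// -expRN.
move=> /le_trans; apply.
apply: (@le_trans _ _ (B0 * expR (x / (t + 1) * t))).
  rewrite /B0 -!mulrA -!expRD le_eqVlt; apply/orP; left; apply/eqP.
  by congr (_ * (_ * expR _)); ring.
apply: (@le_trans _ _ (B0 * (1 + e / (B0 + 1)))).
  rewrite ler_wpM2l// -[leRHS]lnK ?posrE ?addr_gt0// ler_expR -/x.
  rewrite mulrAC ler_pdivrMr// ler_wpM2l// ?(ltW x0)// lerDl//.
rewrite mulrDr mulr1 lerD2l mulrCA ler_piMr ?ltW//.
by rewrite ltr_pdivrMr ?ltr_wpDl// mul1r ltrDl.
Qed.

End seminormed_subspace.

(** * Borel sets and finiteness of the Lebesgue measure *)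

Section rV_borel.
Context {R : realType} {n : nat}.
Local Notation E := 'rV[R]_n.
Local Notation mu := (lebesgue_rV R n).

Lemma rV_ball_measurable (x : E) (e : R) : measurable (ball x e).
Proof.
have [e0|e0] := ltP 0 e; last first.
  rewrite (_ : ball x e = set0)//; apply/seteqP; split => // y [].
  by rewrite ltNge e0.
rewrite (_ : ball x e = \bigcap_(i in [set: 'I_n])
    (@rV_coord R n i @^-1` ball (x ord0 i) e)).
  apply: fin_bigcap_measurable => // i _; rewrite -[X in measurable X]setTI.
  by apply: measurable_rV_coord => //; exact: measurable_ball.
apply/seteqP; split => [y [_ xy] i _|y xy]; first exact: xy.
by split => // i j; rewrite ord1; exact: xy.
Qed.

(** The sigma-algebra is generated by the coordinates, so second countability has to be used: [A] is
    the union of the balls with rational center and radius 1 / (m + 1) that it contains, the other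
    indices contributing the empty set. *)
Lemma rV_open_measurable (A : set E) : open A -> measurable A.
Proof.
move=> oA.
pose F (p : 'rV[rat]_n * nat) : set E :=
  let B := ball (map_mx ratr p.1 : E) p.2.+1%:R^-1 in
  if asbool (B `<=` A) then B else set0.
rewrite (_ : A = \bigcup_p F p).
  apply: countable_bigcupT_measurable => // p; rewrite /F.
  by case: asboolP => // _; exact: rV_ball_measurable.
apply/seteqP; split => [x Ax|x [p _]]; last first.
  by rewrite /F; case: asboolP => // BA /BA.
have /nbhs_ballP[e /= e0 eA] : nbhs x A by exact: open_nbhs_nbhs.
pose m := Num.truncn (2 / e).
have m0 : 0 < m.+1%:R^-1 :> R by rewrite invr_gt0.
(* Twice the radius stays below e, so a ball of this radius that contains x lies in the ball of
   radius e around x. *)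
have me : 2 * m.+1%:R^-1 < e.
  by rewrite ltr_pdivrMr// mulrC -ltr_pdivrMr// truncnS_gt.
have /choice[q qx] : forall i, exists q : rat, `|x ord0 i - ratr q| < m.+1%:R^-1.
  move=> i; have : x ord0 i < x ord0 i + m.+1%:R^-1 by rewrite ltrDl.
  move=> /rat_in_itvoo[q]; rewrite in_itv/= => /andP[xq qx]; exists q.
  by rewrite distrC gtr0_norm ?subr_gt0// ltrBlDl.
have xq : ball (map_mx ratr (\row_i q i) : E) m.+1%:R^-1 x.
  by split => // i j; rewrite ord1 !mxE /ball/= distrC; exact: qx.
exists (\row_i q i, m) => //; rewrite /F/=.
case: asboolP => // -[] y qy; apply: eA; apply: le_ball (ltW me) _ _.
rewrite mulrDl mul1r; exact: ball_triangle (ball_sym xq) qy.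
Qed.

Lemma rV_continuous_measurable (f : E -> R) :
  continuous f -> measurable_fun setT f.
Proof.
move=> /continuousP cf; apply: (measurability _ (RGenOpens.measurableE R)).
move=> _ [_ [a [b ->] <-]]; rewrite setTI; apply: rV_open_measurable.
exact/cf/interval_open.
Qed.

End rV_borel.

Lemma rV_cube_measurable (R : realType) n (r : R) :
  measurable [set x : 'rV[R]_n | forall i, (- r <= x ord0 i <= r)%R].
Proof.
rewrite (_ : mkset _ = \bigcap_(i in [set: 'I_n])
    (@rV_coord R n i @^-1` `[- r, r])).
  apply: fin_bigcap_measurable => // i _; rewrite -[X in measurable X]setTI.
  exact: measurable_rV_coord.
apply/seteqP; split => [y yr i _|y yr i] /=; first by rewrite in_itv/= yr.
by have := yr i I; rewrite /= in_itv.
Qed.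

(** Induction along the recursive definition of the measure: [rV_cons] pulls the cube back to an
    interval times the cube of one dimension less. *)
Lemma lebesgue_rV_cube_lty (R : realType) n (r : R) :
  (lebesgue_rV R n [set x | forall i, (- r <= x ord0 i <= r)%R] < +oo)%E.
Proof.
elim: n => [|n ih].
  by rewrite /= diracE ltry.
rewrite /= /lebesgue_rV_step /pushforward.
rewrite (_ : _ @^-1` _ =
    `[- r, r]%classic `*` [set x : 'rV[R]_n | forall i, - r <= x ord0 i <= r]).
  rewrite [ltLHS]product_measure1E//; last exact: rV_cube_measurable.
  by rewrite lte_mul_pinfty// ?ge0_fin_numE//= lebesgue_measure_itv; case: ifP;
    rewrite ?ltry// -EFinD ltry.
apply/seteqP; split => [[a v] /= av|[a v] /= [ar vr] i].
  split => [|i]; first by have := av ord0; rewrite mxE unlift_none in_itv.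
  by have := av (lift ord0 i); rewrite mxE liftK.
by rewrite mxE; case: unliftP => [j _|_] /=; [exact: vr | rewrite in_itv in ar].
Qed.

Lemma lebesgue_rV_bounded_lty (R : realType) n (A : set 'rV[R]_n) :
  measurable A -> bounded_set A -> (lebesgue_rV R n A < +oo)%E.
Proof.
move=> mA [r [_ Ar]].
apply: le_lt_trans (lebesgue_rV_cube_lty n (r + 1)).
apply: le_measure; rewrite ?inE//; first exact: rV_cube_measurable.
have r1 : r < r + 1 by rewrite ltrDl.
move=> x /(Ar _ r1)/= xr i; rewrite -ler_norml.
apply: le_trans xr; rewrite [leRHS]/Num.norm/= mx_normrE.
exact: (le_bigmax_cond _ (fun ij => `|x ij.1 ij.2|) (j := (ord0, i))).
Qed.

(** * The seminorm of [L^2] *)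

Section L2_norm.
Context {R : realType} {n : nat}.
Local Notation E := 'rV[R]_n.
Local Notation mu := (lebesgue_rV R n).
Variable Omega : set E.
Implicit Types (f g h : E -> R) (a : R).

Lemma restrict_lin a f g : (fun x => a * f x + g x) \_ Omega =
  a *: (f \_ Omega : E -> R^o) + g \_ Omega.
Proof.
apply/funext => x; rewrite /patch; case: ifPn => xO; rewrite !fctE /patch.
  by rewrite xO.
by rewrite (negbTE xO) scaler0 addr0.
Qed.

Lemma L2_lin a f g :
  L2 Omega f -> L2 Omega g -> L2 Omega (fun x => a * f x + g x).
Proof.
move=> Lf Lg; rewrite /L2/= restrict_lin.
have -> : 2%:E = 2%:E :> \bar R by [].
exact: (Lfun_submod_closed mu (lee1n 2)).2.
Qed.

Lemma L2_cst0 : L2 Omega (cst 0).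
Proof.
rewrite /L2/= (_ : cst 0 \_ Omega = 0).
  exact: (Lfun_submod_closed mu (lee1n 2)).1.
by apply/funext => x; rewrite /patch; case: ifP.
Qed.

Lemma L2normE f : L2 Omega f -> (L2norm Omega f)%:E = L2enorm Omega f.
Proof.
rewrite /L2/= inE => /andP[_]; rewrite inE/= /finite_norm => fy.
by rewrite /L2norm fineK// ge0_fin_numE// /L2enorm Lnorm_ge0.
Qed.

Lemma L2norm_ge0 f : 0 <= L2norm Omega f.
Proof. by rewrite fine_ge0// /L2enorm Lnorm_ge0. Qed.

Lemma L2_measurable f : L2 Omega f -> measurable_fun setT (f \_ Omega).
Proof. by rewrite /L2/= inE => /andP[]; rewrite inE. Qed.

Lemma L2P f : measurable_fun setT (f \_ Omega) -> (L2enorm Omega f < +oo)%E ->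
  L2 Omega f.
Proof.
by move=> mf fy; rewrite /L2/= inE; apply/andP; split; rewrite inE.
Qed.

Lemma L2norm_lin_le a f g : L2 Omega f -> L2 Omega g ->
  L2norm Omega (fun x => a * f x + g x) <=
  `|a| * L2norm Omega f + L2norm Omega g.
Proof.
move=> Lf Lg; have Lfg := L2_lin a Lf Lg.
rewrite -lee_fin EFinD EFinM !L2normE// /L2enorm restrict_lin.
have := LnormZ (Lfun_Sub (lee1n 2) Lf) a.
rewrite Lfun_valP => <-.
apply: (@eminkowski _ _ _ mu (a \*: (f \_ Omega : E -> R^o)) (g \_ Omega)) => //.
- by apply: measurable_funM => //; exact: L2_measurable.
- exact: L2_measurable.
- exact: lee1n.
Qed.

Lemma L2normZ a f : L2 Omega f ->
  L2norm Omega (fun x => a * f x) = `|a| * L2norm Omega f.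
Proof.
move=> Lf; rewrite /L2norm /L2enorm.
rewrite (_ : (fun x => a * f x) \_ Omega = a \*: (f \_ Omega : E -> R^o)).
  have := LnormZ (Lfun_Sub (lee1n 2) Lf) a.
  by rewrite Lfun_valP => ->; rewrite -/(L2enorm Omega f) -L2normE//.
by apply/funext => x; rewrite /= /patch; case: ifP => // _; rewrite scaler0.
Qed.

Lemma L2norm_cst0 : L2norm Omega (cst 0) = 0.
Proof.
have := L2normZ 0 L2_cst0; rewrite normr0 mul0r; apply: etrans.
by congr L2norm; apply/funext => x; rewrite mul0r.
Qed.

(** [H01_gradient] states its limits in the extended reals; their algebra is carried out in the
    reals. *)
Lemma L2norm_cvgP (f : (E -> R)^nat) : (forall k, L2 Omega (f k)) ->
  (L2enorm Omega (f k) @[k --> \oo] --> 0%E) <->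
  (L2norm Omega (f k) @[k --> \oo] --> 0).
Proof.
move=> Lf; under eq_fun do rewrite -L2normE//.
split => [/fine_cvgP[]//|f0]; apply/fine_cvgP; split => //; exact: nearW.
Qed.

Definition L2dot f g : R := \int[mu]_(x in Omega) (f x * g x).

Lemma L2dotE f g :
  L2dot f g = \int[mu]_x ((f \_ Omega) x * (g \_ Omega) x).
Proof.
rewrite /L2dot Rintegral_mkcond; congr Rintegral; apply/funext => x.
by rewrite /patch; case: ifP => // _; rewrite mulr0.
Qed.

Let L2_integrable f g : L2 Omega f -> L2 Omega g ->
  mu.-integrable setT (EFin \o (fun x => (f \_ Omega) x * (g \_ Omega) x)).
Proof. by move=> Lf Lg; apply/Lfun1_integrable; exact: Lfun2_mul_Lfun1. Qed.

Lemma L2dot_lin a f g h : L2 Omega f -> L2 Omega g -> L2 Omega h ->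
  L2dot (fun x => a * f x + g x) h = a * L2dot f h + L2dot g h.
Proof.
move=> Lf Lg Lh; rewrite !L2dotE restrict_lin -RintegralZl//; last exact: L2_integrable.
rewrite -RintegralD//; last 2 first.
- exact: (integrableZl measurableT a (L2_integrable Lf Lh)).
- exact: L2_integrable.
congr Rintegral; apply/funext => x; rewrite mulrA -mulrDl; congr (_ * _).
Qed.

Lemma L2dotC f g : L2dot f g = L2dot g f.
Proof. by congr Rintegral; apply/funext => x; rewrite mulrC. Qed.

Lemma L2dot_le f g : L2 Omega f -> L2 Omega g ->
  L2dot f g <= L2norm Omega f * L2norm Omega g.
Proof.
move=> Lf Lg; rewrite L2dotE (le_trans (ler_norm _))//.
apply: le_trans (le_normr_Rintegral _ (L2_integrable Lf Lg)) _ => //.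
rewrite -lee_fin EFinM !L2normE// /Rintegral fineK; last first.
  exact: integrable_fin_num (integrable_norm (L2_integrable Lf Lg)).
have := @hoelder _ _ _ mu _ _ 2 2 (L2_measurable Lf) (L2_measurable Lg).
by rewrite Lnorm1; apply => //; rewrite [RHS]splitr !div1r.
Qed.

Lemma L2dot_eq0 f : L2 Omega f -> L2dot f f = 0 -> L2norm Omega f = 0.
Proof.
move=> Lf; rewrite L2dotE => ff0.
suff : L2enorm Omega f = 0%E by rewrite /L2norm => ->.
apply: (@poweR_eq0_eq0 _ _ 2); first exact: Lnorm_ge0.
rewrite /L2enorm poweR_Lnorm ?pnatr_eq0//.
have : (\int[mu]_x ((f \_ Omega) x * (f \_ Omega) x)%:E)%E = 0%E.
  by rewrite -[LHS]fineK ?integrable_fin_num ?L2_integrable//; congr EFin.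
move=> <-; apply: eq_integral => x _ /=.
by rewrite powR_mulrn// real_normK ?num_real// expr2.
Qed.

End L2_norm.

(** * Test functions and weak gradients *)

Section test_functions.
Context {R : realType} {n : nat}.
Local Notation E := 'rV[R]_n.
Local Notation mu := (lebesgue_rV R n).
Implicit Types (f g : E -> R) (Omega : set E).

Lemma partial_lin (i : 'I_n) (a : R) f g :
  (forall x, derivable f x (basis_vec i)) ->
  (forall x, derivable g x (basis_vec i)) ->
  partial i (fun x => a * f x + g x) =
    (fun x => a * partial i f x + partial i g x) /\
  (forall x, derivable (fun x => a * f x + g x) x (basis_vec i)).
Proof.
move=> df dg; split => [|x].
  apply/funext => x; rewrite /partial -[RHS]/(a *: _ + _) -deriveZ//.
  by rewrite -deriveD//; exact: derivableZ.
by apply: (@derivableD _ _ _ (a \*: f) g) => //; exact: derivableZ.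
Qed.

Lemma Ck_lin k (a : R) f g :
  Ck k setT f -> Ck k setT g -> Ck k setT (fun x => a * f x + g x).
Proof.
have cont f' g' : (forall x, setT x -> {for x, continuous f'}) ->
    (forall x, setT x -> {for x, continuous g'}) ->
    forall x, setT x -> {for x, continuous (fun x => a * f' x + g' x)}.
  move=> cf cg x _.
  apply: (@continuousD _ _ _ (fun x => a * f' x) g'); last exact: cg.
  by apply: (@continuousM _ _ (cst a)); [exact: cst_continuous | exact: cf].
elim: k f g => [|k ih] f g [cf Cf] [cg Cg]; split => //; do ?exact: cont.
move=> i; have [df Cdf] := Cf i; have [dg Cdg] := Cg i.
have [-> dfg] := partial_lin a (fun x => df x I) (fun x => dg x I).
by split => [x _|]; [exact: dfg | exact: ih].
Qed.

Lemma test_function_lin Omega (a : R) f g : test_function Omega f ->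
  test_function Omega g -> test_function Omega (fun x => a * f x + g x).
Proof.
move=> [Cf [K [cK KO f0]]] [Cg [K' [cK' KO' g0]]]; split.
  by move=> k; exact: Ck_lin.
exists (K `|` K'); split.
- exact: compactU.
- by move=> x [/KO|/KO'].
- by move=> x /not_orP[Kx K'x]; rewrite f0// g0// mulr0 addr0.
Qed.

Lemma test_function0 Omega : test_function Omega (cst 0).
Proof.
split; last by exists set0; split; [exact: compact0 | exact: sub0set |].
suff C k : Ck k setT (cst 0 : E -> R) by [].
elim: k => [|k ih]; split => //.
- by move=> x _; exact: cst_continuous.
- by move=> x _; exact: cst_continuous.
- move=> i; split => [x _|]; first exact: derivable_cst.
  rewrite (_ : partial i _ = cst 0)//.
  by apply/funext => x; rewrite /partial derive_cst.
Qed.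

(** The same compact set works: its complement is open, so [f] vanishes near each point outside it,
    and so does the derivative there. *)
Lemma test_function_partial Omega (i : 'I_n) f :
  test_function Omega f -> test_function Omega (partial i f).
Proof.
move=> [Cf [K [cK KO f0]]]; split.
  by move=> k; have [_ /(_ i)[]] := Cf k.+1.
exists K; split => // x Kx; rewrite /partial.
rewrite (@near_eq_derive _ _ _ f (cst 0)) ?derive_cst//.
have oK : open (~` K).
  by apply: closed_openC; apply: compact_closed => //; exact: norm_hausdorff.
exact: filterS f0 (open_nbhs_nbhs (conj oK Kx)).
Qed.

Lemma test_function_continuous Omega f : test_function Omega f -> continuous f.
Proof. by case=> /(_ 0%N)[cf _] _ x; exact: cf. Qed.

(** A continuous function vanishing off a compact set is bounded, and [Omega] has finite measure. *)
Lemma test_function_L2 Omega f : open Omega -> bounded_set Omega ->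
  test_function Omega f -> L2 Omega f.
Proof.
move=> oO bO tf; have cf := test_function_continuous tf.
have mO := rV_open_measurable oO.
have mf := rV_continuous_measurable cf.
apply: L2P.
  apply/(measurable_restrictT _ mO).
  exact: measurable_funTS.
case: tf => _ [K [cK KO f0]].
have [M [_ fM]] : bounded_set (f @` K).
  by apply: compact_bounded; apply: continuous_compact => //; exact: continuous_subspaceT.
(* [bounded_set] only provides bounds strictly above [M]; passing to the absolute value also makes
   the bound nonnegative, as needed where [f] vanishes. *)
have fM1 x : `|f x| <= `|M| + 1.
  have M1 : M < `|M| + 1 by rewrite (le_lt_trans (ler_norm _))// ltrDl.
  have [Kx|Kx] := pselect (K x); first by apply: (fM _ M1); exists x.
  by rewrite f0// normr0 addr_ge0.
rewrite /L2enorm unlock poweR_lty//.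
have : mu.-integrable Omega (EFin \o (fun x => f x ^+ 2)).
  apply: measurable_bounded_integrable => //.
  - exact: lebesgue_rV_bounded_lty.
  - exact/measurable_funTS/measurable_funX.
  exists ((`|M| + 1) ^+ 2); split; first by rewrite num_real.
  move=> N MN x _ /=; rewrite normrX; apply: le_trans (ltW MN).
  by rewrite lerXn2r ?nnegrE// addr_ge0.
move=> /integrableP[_]; apply: le_lt_trans; rewrite [leRHS]integral_mkcond.
rewrite le_eqVlt; apply/orP; left; apply/eqP. apply: eq_integral => x _.
rewrite /patch/=; case: ifP => _ /=; last by rewrite normr0 powR0 ?pnatr_eq0.
by rewrite powR_mulrn// normrX.
Qed.

End test_functions.

Lemma cvgn_lin0 (R : realType) (c : R) (p q : R^nat) :
  p k @[k --> \oo] --> 0 -> q k @[k --> \oo] --> 0 ->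
  c * (p k + q k) @[k --> \oo] --> 0.
Proof.
move=> p0 q0; have -> : 0 = c * (0 + 0) by rewrite addr0 mulr0.
by apply: cvgMl_tmp; exact: cvgD.
Qed.

(** * Linearity and uniqueness of weak gradients in H^1_0 *)

Section weak_gradient.
Context {R : realType} {n : nat}.
Local Notation E := 'rV[R]_n.
Local Notation mu := (lebesgue_rV R n).
Variable Omega : set E.
Hypotheses (Omega_open : open Omega) (Omega_bounded : bounded_set Omega).
Implicit Types (u v f : E -> R) (g h : 'I_n -> E -> R).

Let testL2 f : test_function Omega f -> L2 Omega f.
Proof. exact: test_function_L2. Qed.

Let subE u v : u - v = (fun x => -1 * v x + u x).
Proof. by apply/funext => x; rewrite mulN1r addrC. Qed.

Let L2B u v : L2 Omega u -> L2 Omega v -> L2 Omega (u - v).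
Proof. by move=> Lu Lv; rewrite subE; exact: L2_lin. Qed.

Lemma L2norm_sub_le u v : L2 Omega u -> L2 Omega v ->
  L2norm Omega u <= L2norm Omega v + L2norm Omega (u - v).
Proof.
move=> Lu Lv.
have := L2norm_lin_le 1 Lv (L2B Lu Lv); rewrite normr1 mul1r; apply: le_trans.
by rewrite le_eqVlt; apply/orP; left; apply/eqP; congr L2norm; apply/funext => x;
  rewrite !fctE; ring.
Qed.

(** The same combination of the approximating test functions approximates the combined function and
    its gradient. *)
Lemma H01_gradient_lin (a : R) u v g h :
  H01_gradient Omega u g -> H01_gradient Omega v h ->
  H01_gradient Omega (fun x => a * u x + v x) (fun i x => a * g i x + h i x).
Proof.
move=> [[Lu gu] [phi [tphi uphi gphi]]] [[Lv hv] [psi [tpsi vpsi hpsi]]].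
have cvg_lin (f1 f2 : E -> R) (p1 p2 : (E -> R)^nat) :
    L2 Omega f1 -> L2 Omega f2 ->
    (forall k, L2 Omega (p1 k)) -> (forall k, L2 Omega (p2 k)) ->
    L2enorm Omega (f1 - p1 k) @[k --> \oo] --> 0%E ->
    L2enorm Omega (f2 - p2 k) @[k --> \oo] --> 0%E ->
    L2enorm Omega ((fun x => a * f1 x + f2 x) - (fun x => a * p1 k x + p2 k x))
      @[k --> \oo] --> 0%E.
  move=> L1 L2' Lp1 Lp2.
  move=> /(L2norm_cvgP (fun k => L2B L1 (Lp1 k))) c1.
  move=> /(L2norm_cvgP (fun k => L2B L2' (Lp2 k))) c2.
  apply/L2norm_cvgP.
    by move=> k; apply: L2B; exact: L2_lin.
  apply: (@squeeze_cvgr _ _ _ _ (cst 0) (fun k =>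
      `|a| * L2norm Omega (f1 - p1 k) + L2norm Omega (f2 - p2 k))).
  - apply: nearW => k; rewrite L2norm_ge0/=.
    apply: le_trans (L2norm_lin_le a (L2B L1 (Lp1 k)) (L2B L2' (Lp2 k))).
    rewrite le_eqVlt; apply/orP; left; apply/eqP; congr L2norm.
    by apply/funext => x; rewrite !fctE; ring.
  - exact: cvg_cst.
  - rewrite -[X in _ --> X]addr0 -[X in _ --> X + _](mulr0 `|a|).
    by apply: cvgD => //; apply: cvgMl_tmp.
have dphi i k x : derivable (phi k) x (basis_vec i).
  by have [/(_ 1%N)[_ /(_ i)[+ _]] _] := tphi k; exact.
have dpsi i k x : derivable (psi k) x (basis_vec i).
  by have [/(_ 1%N)[_ /(_ i)[+ _]] _] := tpsi k; exact.
split.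
  split; first exact: L2_lin.
  move=> i; have [Lg wg] := gu i; have [Lh wh] := hv i.
  split; first exact: L2_lin.
  move=> f tf; have Lf := testL2 tf.
  have Lf' := testL2 (test_function_partial i tf).
  have := L2dot_lin a Lu Lv Lf'; rewrite /L2dot => ->.
  have := L2dot_lin a Lg Lh Lf; rewrite /L2dot => ->.
  by rewrite wg// wh// mulrN opprD.
exists (fun k x => a * phi k x + psi k x); split.
- by move=> k; exact: test_function_lin.
- by apply: cvg_lin => // k; exact: testL2.
- move=> i; under eq_fun do
    rewrite (partial_lin a (fun x => dphi i _ x) (fun x => dpsi i _ x)).1.
  by apply: cvg_lin => //; [exact: (gu i).1 | exact: (hv i).1 | |] => k;
    apply/testL2/test_function_partial.
Qed.

(* The difference [d] of two weak gradients of [u] is orthogonal in [L^2] to every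
   test function, in particular to the partial derivatives of the test functions
   approximating [u] in [H^1]. Combinations of the latter converge to [d], so
   [d = 0] and density of test functions in [L^2] is not needed. *)
Lemma H01_gradient_unique u g h i :
  H01_gradient Omega u g -> H01_gradient Omega u h ->
  L2norm Omega (g i) = L2norm Omega (h i).
Proof.
move=> [[_ /(_ i)[Lg wg]] [phi [tphi _ /(_ i) gphi]]].
move=> [[_ /(_ i)[Lh wh]] [psi [tpsi _ /(_ i) hpsi]]].
pose d := g i - h i.
have Ld : L2 Omega d by exact: L2B.
have Lphi k : L2 Omega (partial i (phi k)) by exact/testL2/test_function_partial.
have Lpsi k : L2 Omega (partial i (psi k)) by exact/testL2/test_function_partial.
(* Tested against f, both gradients give minus the integral of u times the partial derivative of
   f. *)
have d0 f : test_function Omega f -> L2dot Omega d f = 0.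
  move=> tf; rewrite /d subE L2dot_lin//; last exact: testL2.
  rewrite /L2dot (oppr_inj (etrans (esym (wg _ tf)) (wh _ tf))).
  by rewrite mulN1r addNr.
suff dd0 : L2norm Omega d = 0.
  apply/eqP; rewrite eq_le; apply/andP; split.
    by have := L2norm_sub_le Lg Lh; rewrite -/d dd0 addr0.
  have := L2norm_sub_le Lh Lg; rewrite (_ : L2norm Omega (h i - g i) = 0) ?addr0//.
  have := L2normZ (-1) Ld; rewrite dd0 mulr0; apply: etrans; congr L2norm.
  by apply/funext => x; rewrite /d !fctE mulN1r opprB.
apply: L2dot_eq0 => //.
have dd k : L2dot Omega d d <= L2norm Omega d *
    (L2norm Omega (h i - partial i (psi k)) + L2norm Omega (g i - partial i (phi k))).
  have LA := L2B Lg (Lphi k); have LB := L2B Lh (Lpsi k).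
  (* The combination [c] of derivatives of test functions is orthogonal to [d], and d - c consists
     of the two approximation errors only. *)
  have dE : L2dot Omega d d =
      L2dot Omega d (fun x => -1 * (h i - partial i (psi k)) x + (g i - partial i (phi k)) x).
    pose c := (fun x => -1 * partial i (psi k) x + partial i (phi k) x).
    have Lc : L2 Omega c by exact: L2_lin.
    have c0 : L2dot Omega c d = 0.
      rewrite L2dot_lin// L2dotC d0 ?mulr0 ?add0r; last exact: test_function_partial.
      by rewrite L2dotC d0//; exact: test_function_partial.
    rewrite [RHS]L2dotC.
    rewrite (_ : (fun x => _) = (fun x => -1 * c x + d x)).
      by rewrite L2dot_lin// c0 mulr0 add0r.
    by apply/funext => x; rewrite /c /d !fctE; ring.
  rewrite dE; apply: le_trans (L2dot_le Ld (L2_lin _ LB LA)) _.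
  rewrite ler_wpM2l ?L2norm_ge0//.
  by have := L2norm_lin_le (-1) LB LA; rewrite normrN1 mul1r.
move/(L2norm_cvgP (fun k => L2B Lg (Lphi k))) : gphi => gphi.
move/(L2norm_cvgP (fun k => L2B Lh (Lpsi k))) : hpsi => hpsi.
apply/eqP; rewrite eq_le; apply/andP; split; last first.
  by apply: Rintegral_ge0 => x _; rewrite -expr2 sqr_ge0.
rewrite -(cvg_lim _ (cvgn_lin0 (L2norm Omega d) hpsi gphi))//.
by apply: limr_ge; [apply/cvg_ex; exists 0; exact: cvgn_lin0 | exact: nearW].
Qed.

(** This frees [grad_norm] from the choice made by [get]: any weak gradient computes it. *)
Lemma grad_normE u g : H01_gradient Omega u g ->
  grad_norm Omega u = Num.sqrt (\sum_i L2norm Omega (g i) ^+ 2).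
Proof.
move=> ug; rewrite /grad_norm; congr Num.sqrt; apply: eq_bigr => i _.
have wg : H01_gradient Omega u (weak_grad Omega u) by apply: getPex; exists g.
by rewrite (H01_gradient_unique i wg ug).
Qed.

Lemma H01_lin (a : R) u v :
  H01 Omega u -> H01 Omega v -> H01 Omega (fun x => a * u x + v x).
Proof.
move=> [g ug] [h vh]; exists (fun i x => a * g i x + h i x).
exact: H01_gradient_lin.
Qed.

Lemma H01_gradient0 : H01_gradient Omega (cst 0) (fun=> cst 0).
Proof.
have e0 : L2enorm Omega (cst 0) = 0%E.
  by rewrite -L2normE ?L2norm_cst0//; exact: L2_cst0.
have cvg0 (p : (E -> R)^nat) : (forall k, p k = cst 0) ->
    L2enorm Omega (cst 0 - p k) @[k --> \oo] --> 0%E.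
  move=> p0; rewrite (_ : (fun k => _) = cst 0%E); first exact: cvg_cst.
  by apply/funext => k; rewrite p0 -[cst 0]/(0 : E -> R) subr0 e0.
have int0 (p : E -> R) : \int[mu]_(x in Omega) (cst 0 x * p x) = 0.
  rewrite /Rintegral (eq_integral (cst 0%E)) ?integral0// => x _.
  by rewrite mul0r.
split.
  split; first exact: L2_cst0.
  move=> i; split; first exact: L2_cst0.
  by move=> f _; rewrite !int0 oppr0.
exists (fun=> cst 0); split; first by move=> _; exact: test_function0.
- exact: cvg0.
- move=> i; apply: cvg0 => _.
  by apply/funext => x; rewrite /partial derive_cst.
Qed.

Lemma grad_norm0 : grad_norm Omega (cst 0) = 0.
Proof.
rewrite (grad_normE H01_gradient0) big1 ?sqrtr0// => i _.
by rewrite L2norm_cst0 expr0n.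
Qed.

End weak_gradient.

(** * Essential bounds and the energy norm *)

(** Minkowski's inequality in the plane. In the Cauchy-Schwarz step the difference of the squares is
    (A y - B x)^2. *)
Lemma sqrt_sqrD_le (R : rcfType) (A B C x y z : R) :
  0 <= A -> 0 <= B -> 0 <= C <= A + B -> 0 <= x -> 0 <= y -> 0 <= z <= x + y ->
  Num.sqrt (C ^+ 2 + z ^+ 2) <=
  Num.sqrt (A ^+ 2 + x ^+ 2) + Num.sqrt (B ^+ 2 + y ^+ 2).
Proof.
move=> A0 B0 /andP[C0 CAB] x0 y0 /andP[z0 zxy].
rewrite -(@ler_pXn2r _ 2)// ?nnegrE ?addr_ge0 ?sqrtr_ge0//.
rewrite sqrrD !sqr_sqrtr ?addr_ge0 ?sqr_ge0//.
have ABxy : A * B + x * y <= Num.sqrt (A ^+ 2 + x ^+ 2) * Num.sqrt (B ^+ 2 + y ^+ 2).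
  rewrite -sqrtrM ?addr_ge0 ?sqr_ge0// -[leLHS]ger0_norm ?addr_ge0 ?mulr_ge0//.
  rewrite -sqrtr_sqr ler_sqrt ?mulr_ge0 ?addr_ge0 ?sqr_ge0//.
  by rewrite -subr_ge0; have := sqr_ge0 (A * y - B * x); congr (0 <= _); ring.
have : C ^+ 2 <= (A + B) ^+ 2 by rewrite lerXn2r ?nnegrE ?addr_ge0.
have : z ^+ 2 <= (x + y) ^+ 2 by rewrite lerXn2r ?nnegrE ?addr_ge0.
by rewrite !sqrrD; lra.
Qed.

(** Induction with the first m squares regrouped as the square of their root. It serves both the
    components of a gradient and the four components of a state. *)
Lemma sqrt_sum_sqr_le (R : rcfType) m (a b c : 'I_m -> R) :
  (forall i, 0 <= a i) -> (forall i, 0 <= b i) ->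
  (forall i, 0 <= c i <= a i + b i) ->
  Num.sqrt (\sum_i c i ^+ 2) <=
  Num.sqrt (\sum_i a i ^+ 2) + Num.sqrt (\sum_i b i ^+ 2).
Proof.
elim: m a b c => [|m ih] a b c a0 b0 cab.
  by rewrite !big_ord0 sqrtr0 addr0.
rewrite !big_ord_recr/=; set w := widen_ord (leqnSn m).
have sq0 (d : 'I_m.+1 -> R) : 0 <= \sum_(i < m) d (w i) ^+ 2.
  by apply: sumr_ge0 => i _; exact: sqr_ge0.
rewrite -(sqr_sqrtr (sq0 a)) -(sqr_sqrtr (sq0 b)) -(sqr_sqrtr (sq0 c)).
apply: sqrt_sqrD_le; rewrite ?sqrtr_ge0//=.
by apply: (ih (a \o w) (b \o w) (c \o w)) => i /=.
Qed.

Lemma sqrt_sum_sqrM (R : rcfType) m (a : R) (c : 'I_m -> R) : 0 <= a ->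
  Num.sqrt (\sum_i (a * c i) ^+ 2) = a * Num.sqrt (\sum_i c i ^+ 2).
Proof.
move=> a0; under eq_bigr do rewrite exprMn.
by rewrite -mulr_sumr sqrtrM ?sqr_ge0// sqrtr_sqr ger0_norm.
Qed.

(** Sublinearity gives one half of homogeneity; the other half follows by scaling back with the
    inverse of a. *)
Lemma is_seminorm_onP (R : realType) (V : lmodType R) (H : set V) (N : V -> R) :
  H 0 -> (forall (a : R) u v, H u -> H v -> H (a *: u + v)) -> N 0 = 0 ->
  (forall (a : R) u v, H u -> H v -> N (a *: u + v) <= `|a| * N u + N v) ->
  is_seminorm_on H N.
Proof.
move=> H0 HP N0 NP; split => // [u v Hu Hv|a u Hu].
  by have := NP 1 u v Hu Hv; rewrite scale1r normr1 mul1r.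
have NZ (b : R) v : H v -> N (b *: v) <= `|b| * N v.
  by move=> Hv; have := NP b v 0 Hv H0; rewrite N0 !addr0.
have HZ (b : R) v : H v -> H (b *: v) by move=> Hv; rewrite -[_ *: _]addr0; exact: HP.
apply/eqP; rewrite eq_le NZ//=; have [->|a0] := eqVneq a 0.
  by rewrite scale0r N0 normr0 mul0r.
rewrite -ler_pdivlMl ?normr_gt0// -normfV.
by have := NZ a^-1 _ (HZ a _ Hu); rewrite scalerA mulVf// scale1r.
Qed.

Section essential_bounds.
Context {R : realType} {n : nat}.
Local Notation E := 'rV[R]_n.
Local Notation mu := (lebesgue_rV R n).
Variable Omega : set E.
Implicit Types (a f g : E -> R).

Lemma Linfty_norm_ge0 a : 0 <= Linfty_norm Omega a.
Proof. by rewrite fine_ge0// Lnorm_ge0. Qed.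

Lemma Linfty_ae_le a : Linfty Omega a ->
  {ae mu, forall x, `|(a \_ Omega) x| <= Linfty_norm Omega a}.
Proof.
rewrite /Linfty/= inE => /andP[_]; rewrite inE/= /finite_norm => ay.
(* The norm at infinity is an essential supremum only when the whole space has positive measure;
   otherwise the whole space is itself the exceptional null set. *)
have [mu0|] := ltP 0%E (mu setT); last first.
  move=> mu0; exists setT; split => //.
  by apply/eqP; rewrite eq_le mu0/=; exact: measure_ge0.
have aE : (Linfty_norm Omega a)%:E = 'N[mu]_+oo[EFin \o (a \_ Omega)]%E.
  by rewrite fineK// ge0_fin_numE// Lnorm_ge0.
have := ess_sup_ge mu (abse \o (EFin \o (a \_ Omega))).
apply: filterS => x /=; rewrite -lee_fin aE unlock mu0.
exact.
Qed.

Lemma Linfty_funrneg a : Linfty Omega a -> Linfty Omega a^\-.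
Proof.
rewrite /Linfty/= !inE => /andP[]; rewrite !inE/= /finite_norm => ma ay.
have aE : a^\- \_ Omega = (a \_ Omega)^\-.
  apply/funext => x; rewrite /funrneg /patch; case: ifP => //.
  by rewrite oppr0 maxxx.
rewrite aE; apply/andP; split; rewrite inE/=; first exact: measurable_funrneg.
rewrite /finite_norm; apply: le_lt_trans ay; rewrite unlock; case: ifP => // mu0.
apply: le_ess_sup; apply: nearW => x /=; rewrite lee_fin /funrneg.
rewrite ger0_norm ?le_max ?lexx ?orbT// ge_max normr_ge0 andbT.
by rewrite -normrN ler_norm.
Qed.

Lemma L2enorm_le f g : measurable_fun setT (f \_ Omega) ->
  measurable_fun setT (g \_ Omega) ->
  {ae mu, forall x, `|(f \_ Omega) x| <= `|(g \_ Omega) x|} ->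
  (L2enorm Omega f <= L2enorm Omega g)%E.
Proof.
move=> mf mg fg; rewrite /L2enorm unlock.
have mp (h : E -> R) : measurable_fun setT h ->
    measurable_fun setT (fun x => (`|(EFin \o h) x| `^ 2)%E).
  move=> mh; apply/measurable_EFinP.
  apply: (measurableT_comp (measurable_powR 2)).
  exact: measurableT_comp.
apply: gt0_ler_poweR.
- by rewrite invr_ge0.
- by rewrite in_itv/= leey integral_ge0.
- by rewrite in_itv/= leey integral_ge0.
apply: ae_ge0_le_integral => //; do ?exact: mp.
- by move=> x _; exact: poweR_ge0.
- by move=> x _; exact: poweR_ge0.
- by move: fg; apply: filterS => x fgx _ /=; rewrite lee_fin ge0_ler_powR ?nnegrE.
Qed.

Lemma L2_mul_Linfty a f : Linfty Omega a -> L2 Omega f ->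
  L2 Omega (a \* f) /\
  L2norm Omega (a \* f) <= Linfty_norm Omega a * L2norm Omega f.
Proof.
move=> La Lf; set K := Linfty_norm Omega a.
(* The dominating function K f carries a zero summand to match the shape of [L2_lin] and
   [L2norm_lin_le]. *)
have LKf : L2 Omega (fun x => K * f x + cst 0 x) by exact/L2_lin/L2_cst0.
have maf : measurable_fun setT ((a \* f) \_ Omega).
  rewrite (_ : _ \_ _ = (a \_ Omega) \* (f \_ Omega)).
    apply: measurable_funM; last exact: L2_measurable.
    by move: La; rewrite /Linfty/= inE => /andP[]; rewrite inE.
  by apply/funext => x; rewrite /= /patch; case: ifP => // _; rewrite mulr0.
have le : (L2enorm Omega (a \* f)%R <= L2enorm Omega (fun x => K * f x + cst 0 x)%R)%E.
  apply: L2enorm_le => //; first exact: L2_measurable.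
  have := Linfty_ae_le La; apply: filterS => x; rewrite /= /patch; case: ifP => //= _ aK.
  rewrite addr0 !normrM; apply: ler_wpM2r => //.
  by rewrite [leRHS]ger0_norm ?Linfty_norm_ge0.
have Laf : L2 Omega (a \* f).
  by apply: L2P => //; apply: le_lt_trans le _; rewrite -L2normE// ltry.
split => //; rewrite -lee_fin L2normE//; apply: le_trans le _.
rewrite -L2normE// lee_fin.
have := L2norm_lin_le K Lf (@L2_cst0 _ _ Omega).
by rewrite L2norm_cst0 addr0 ger0_norm ?Linfty_norm_ge0.
Qed.

End essential_bounds.

(** * The energy seminorm and the bounds on damping and nonlinearity *)

Section energy_space.
Context {R : realType} {n : nat}.
Local Notation E := 'rV[R]_n.
Variable Omega : set E.
Hypotheses (Omega_open : open Omega) (Omega_bounded : bounded_set Omega).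
Implicit Types (u v : E -> R) (U V W : state R n).

Lemma grad_norm_ge0 u : 0 <= grad_norm Omega u.
Proof. exact: sqrtr_ge0. Qed.

Lemma grad_norm_lin_le (a : R) u v : H01 Omega u -> H01 Omega v ->
  grad_norm Omega (fun x => a * u x + v x) <=
  `|a| * grad_norm Omega u + grad_norm Omega v.
Proof.
move=> [g ug] [h vh]; have uvgh := H01_gradient_lin Omega_open Omega_bounded a ug vh.
rewrite (grad_normE Omega_open Omega_bounded ug).
rewrite (grad_normE Omega_open Omega_bounded vh).
rewrite (grad_normE Omega_open Omega_bounded uvgh) -sqrt_sum_sqrM//.
apply: sqrt_sum_sqr_le => i; rewrite ?mulr_ge0 ?L2norm_ge0//=.
by apply: L2norm_lin_le; [exact: (ug.1.2 i).1 | exact: (vh.1.2 i).1].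
Qed.

(** Makes the energy norm a Euclidean norm of four seminorms, so that the finite Minkowski
    inequality applies to it. *)
Definition energy_components U (i : 'I_4) : R :=
  let: (u1, u2, y1, y2) := U in
  nth 0 [:: grad_norm Omega u1; L2norm Omega u2;
            grad_norm Omega y1; L2norm Omega y2] i.

Lemma energy_normE U :
  energy_norm Omega U = Num.sqrt (\sum_i energy_components U i ^+ 2).
Proof.
by case: U => [[[u1 u2] y1] y2]; rewrite /= !big_ord_recr/= big_ord0 add0r.
Qed.

Lemma energy_components_ge0 U i : 0 <= energy_components U i.
Proof.
case: U => [[[u1 u2] y1] y2]; case: i => -[|[|[|[|//]]]] ? /=;
  by rewrite ?grad_norm_ge0 ?L2norm_ge0.
Qed.

Lemma energy_components_le U i : energy_components U i <= energy_norm Omega U.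
Proof.
rewrite energy_normE -[leLHS]ger0_norm ?energy_components_ge0// -sqrtr_sqr.
rewrite ler_sqrt; last by apply: sumr_ge0 => j _; exact: sqr_ge0.
by rewrite (bigD1 i)//= lerDl; apply: sumr_ge0 => j _; exact: sqr_ge0.
Qed.

Lemma energy_norm_le (c : R) U V : 0 <= c ->
  (forall i, energy_components U i <= c * energy_components V i) ->
  energy_norm Omega U <= c * energy_norm Omega V.
Proof.
move=> c0 UV; rewrite !energy_normE -sqrt_sum_sqrM// ler_sqrt.
  apply: ler_sum => i _; rewrite lerXn2r ?nnegrE ?energy_components_ge0//.
  by rewrite mulr_ge0 ?energy_components_ge0.
by apply: sumr_ge0 => i _; exact: sqr_ge0.
Qed.

Lemma energy_norm_seminorm :
  is_seminorm_on (energy_space Omega) (energy_norm Omega).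
Proof.
apply: is_seminorm_onP.
- have H0 : H01 Omega (cst 0) by exists (fun=> cst 0); exact: H01_gradient0.
  have L0 : L2 Omega (cst 0) by exact: L2_cst0.
  by split.
- move=> a [[[u1 u2] y1] y2] [[[v1 v2] z1] z2] [u1H u2H y1H y2H] [v1H v2H z1H z2H].
  have := And4 (H01_lin Omega_open Omega_bounded a u1H v1H) (L2_lin a u2H v2H)
    (H01_lin Omega_open Omega_bounded a y1H z1H) (L2_lin a y2H z2H).
  exact.
- rewrite energy_normE big1 ?sqrtr0// => i _.
  by case: i => -[|[|[|[|//]]]] ? /=;
    rewrite ?(grad_norm0 Omega_open Omega_bounded) ?L2norm_cst0 expr0n.
move=> a U V HU HV; rewrite !energy_normE -sqrt_sum_sqrM//.
apply: sqrt_sum_sqr_le => i; rewrite ?mulr_ge0 ?energy_components_ge0//=.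
case: U V HU HV => [[[u1 u2] y1] y2] [[[v1 v2] z1] z2].
move=> [u1H u2H y1H y2H] [v1H v2H z1H z2H].
by case: i => -[|[|[|[|//]]]] ? /=;
  do ?[exact: grad_norm_lin_le | exact: L2norm_lin_le].
Qed.

Lemma damping_bound (a : E -> R) W : Linfty Omega a -> energy_space Omega W ->
  energy_space Omega (pointwise_mul a (proj_P W)) /\
  energy_norm Omega (pointwise_mul a (proj_P W)) <=
    Linfty_norm Omega a * energy_norm Omega W.
Proof.
case: W => [[[u1 u2] y1] y2] La [u1H u2H y1H y2H].
have [Lay ay] := L2_mul_Linfty La y2H.
have a0 : a \* (0 : E -> R^o) = cst 0 by apply/funext => x /=; rewrite mulr0.
have H0 : H01 Omega (cst 0) by exists (fun=> cst 0); exact: H01_gradient0.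
rewrite /pointwise_mul /proj_P a0; split; first by split => //; exact: L2_cst0.
apply: energy_norm_le; first exact: Linfty_norm_ge0.
by case=> -[|[|[|[|//]]]] ? /=; rewrite ?(grad_norm0 Omega_open Omega_bounded)
  ?L2norm_cst0 ?mulr_ge0 ?Linfty_norm_ge0 ?grad_norm_ge0 ?L2norm_ge0.
Qed.

(** Because f(0) = 0, the local Lipschitz estimate against the zero function is a linear growth
    bound on the ball of radius r. *)
Lemma nonlinearity_bound (f1 f2 L : R -> R) (r : R) W : 0 < r ->
  hypothesis_N Omega f1 f2 L -> energy_space Omega W ->
  energy_norm Omega W <= r ->
  energy_space Omega (nonlinearity f1 f2 W) /\
  energy_norm Omega (nonlinearity f1 f2 W) <= L r * energy_norm Omega W.
Proof.
move=> r0 [[cf1 cf2] [f10 f20] /(_ _ r0)[/ltW Lr lip] _ _] WH Wr.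
have H0 : H01 Omega (cst 0) by exists (fun=> cst 0); exact: H01_gradient0.
have bound f u : continuous f -> f 0 = 0 -> f = f1 \/ f = f2 -> H01 Omega u ->
    grad_norm Omega u <= r ->
    L2 Omega (f \o u) /\ L2norm Omega (f \o u) <= L r * grad_norm Omega u.
  move=> cf f0 f12 uH ur.
  have := lip f f12 u (cst 0) uH H0 ur.
  rewrite (grad_norm0 Omega_open Omega_bounded) (ltW r0) => /(_ isT).
  have -> : (f \o u) - (f \o cst 0) = f \o u.
    by apply/funext => x; rewrite !fctE f0 subr0.
  have -> : u - cst 0 = u by apply/funext => x; rewrite !fctE subr0.
  (* The estimate concerns the extended norm, so it also yields finiteness; f(0) = 0 lets
     restriction to [Omega] commute with composition, whence measurability. *)
  move=> fu; have Lfu : L2 Omega (f \o u).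
    apply: L2P; last by apply: le_lt_trans fu _; rewrite ltry.
    rewrite (_ : _ \_ _ = f \o (u \_ Omega)).
      apply: measurableT_comp; first exact: continuous_measurable_fun.
      by case: uH => g [[Lu _] _]; exact: L2_measurable.
    by apply/funext => x; rewrite /= /patch; case: ifP.
  by split => //; rewrite -lee_fin L2normE.
case: W WH Wr => [[[u1 u2] y1] y2] WH Wr; have [u1H u2H y1H y2H] := WH.
pose W4 : state R n := (u1, u2, y1, y2).
have [] := bound f1 u1 cf1 f10 (or_introl erefl) u1H.
  by have /= /le_trans := energy_components_le W4 (@Ordinal 4 0 isT); exact.
move=> L1 N1.
have [] := bound f2 y1 cf2 f20 (or_intror erefl) y1H.
  by have /= /le_trans := energy_components_le W4 (@Ordinal 4 2 isT); exact.
move=> L2' N2; split; first by split.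
have g0 : grad_norm Omega (0 : E -> R^o) = 0 by exact: grad_norm0.
(* Velocity components of the image are controlled by position components of the argument, so whole
   sums of squares are compared. *)
rewrite /energy_norm/= g0 expr0n add0r addr0.
rewrite -[X in X * Num.sqrt _]ger0_norm// -sqrtr_sqr -sqrtrM ?sqr_ge0//.
apply: ler_wsqrtr.
have sqle (x y : R) : 0 <= x -> 0 <= y -> x <= L r * y -> x ^+ 2 <= L r ^+ 2 * y ^+ 2.
  by move=> x0 y0 xy; rewrite -exprMn lerXn2r ?nnegrE ?mulr_ge0.
have := sqle _ _ (L2norm_ge0 _ _) (grad_norm_ge0 u1) N1.
have := sqle _ _ (L2norm_ge0 _ _) (grad_norm_ge0 y1) N2.
have := mulr_ge0 (sqr_ge0 (L r)) (sqr_ge0 (L2norm Omega u2)).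
have := mulr_ge0 (sqr_ge0 (L r)) (sqr_ge0 (L2norm Omega y2)).
by rewrite !mulrDr; lra.
Qed.

End energy_space.

Theorem theorem3p3 (R : realType) (n : nat) (n_gt0 : (0 < n)%N)
    (Omega omega omegab : set 'rV[R]_n)
    (Omega_open : open Omega) (Omega_connected : connected Omega)
    (Omega_bounded : bounded_set Omega) (Omega_C2 : C2_boundary Omega)
    (omega_open : open omega) (omega_sub : omega `<=` Omega)
    (omegab_open : open omegab) (omegab_neq0 : omegab !=set0)
    (a1 a2 b : 'rV[R]_n -> R)
    (a1_damping : damping_coefficient Omega omega a1)
    (a2_bounded : Linfty Omega a2)
    (b_coupling : coupling_coefficient Omega omegab b)
    (geometry : geometric_control Omega omega omegab \/
       exists bstar : R, piecewise_multipliers Omega omega omegab b bstar)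
    (S : R -> state R n -> state R n)
    (S_generated : wave_semigroup Omega a1 b a2^\+ S)
    (S_contraction : contraction_semigroup (energy_space Omega)
       (energy_norm Omega) S)
    (M alpha : R) (M_gt0 : 0 < M) (alpha_gt0 : 0 < alpha)
    (S_decay : exp_bound Omega S M alpha)
    (f1 f2 L : R -> R) (f_N : hypothesis_N Omega f1 f2 L)
    (a2_small : Linfty_norm Omega a2^\- < alpha / M)
    (T : R) (T_gt0 : 0 < T)
    (U0 : state R n) (U0_H : energy_space Omega U0)
    (U : R -> state R n)
    (U_sol : mild_solution (energy_space Omega) (energy_norm Omega) S
       (fun W => pointwise_mul a2^\- (proj_P W)) (nonlinearity f1 f2) U0 T U)
    (Crho : R) (Crho_gt0 : 0 < Crho)
    (U_bounded : forall t : R, 0 <= t < T -> energy_norm Omega (U t) <= Crho)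
    (L_small : L Crho < (alpha - M * Linfty_norm Omega a2^\-) / M) :
  forall t : R, 0 <= t < T ->
    energy_norm Omega (U t) <=
      M * energy_norm Omega U0 *
      expR (- (alpha - M * Linfty_norm Omega a2^\- - M * L Crho) * t).
Proof.
have [[HS _ _ _ _] _] := S_contraction.
(* The constants are K1 = |a2^-|_oo, K2 = L(Crho) and C = Crho. *)
apply: (@mild_solution_decay _ _ _ _ (energy_norm_seminorm Omega_open Omega_bounded)
  _ _ _ _ _ _ _ _ _ _ _ M_gt0 _ _ U0_H _ S_decay _ U_sol).
- exact: Linfty_norm_ge0.
- by case: f_N => _ _ /(_ _ Crho_gt0)[/ltW].
- by move=> t u t0; exact: HS.
move=> t tT; have UH := U_sol.1.1 _ tT; have UC := U_bounded _ tT; split.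
- exact: UC.
- by apply: damping_bound => //; exact: Linfty_funrneg.
- exact: nonlinearity_bound.
Qed.
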